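(* Let $R$ be a noetherian commutative ring and let $N\subset M$ be an $R$-submodule of an $R$-module $M$ such that $M/N\neq 0$ is finitely generated. Then $\operatorname{Jac}(N)\neq M$ and $\operatorname{rad}(N)\neq M$.
   Context: For $R$-modules $N\subseteq M$: $$\operatorname{rad}(N)=\{s\in M:\ s\otimes 1\in\operatorname{im}(N\otimes_RK\to M\otimes_RK)\text{ for all ring homomorphisms }R\to K\text{ to a field }K\},$$ $$\operatorname{Jac}(N)=\{s\in M:\ s\otimes 1\in\operatorname{im}(N\otimes_R\kappa(\mathfrak m)\to M\otimes_R\kappa(\mathfrak m))\text{ for all maximal ideals }\mathfrak m\text{ of }R\},$$ where $\kappa(\mathfrak m)=R/\mathfrak m$. *)

(* Defs.v *)
From HB Require Import structures.
From mathcomp Require Import all_boot all_order all_algebra ring_quotient.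
From mathcomp Require Import boolp classical_sets.
From mathcomp Require Import freeg.

Set Implicit Arguments.
Unset Strict Implicit.
Unset Printing Implicit Defensive.

Import GRing.Theory.
Local Open Scope ring_scope.
Local Open Scope quotient_scope.

Definition finitely_generated (R : pzRingType) (V : lmodType R) : Prop :=
  exists (n : nat) (x : 'I_n -> V),
    forall v : V, exists c : 'I_n -> R, v = \sum_i c i *: x i.

Section Submodule.
Context (R : pzRingType) (M : lmodType R) (N : submodClosed M).

Definition submod : Type := {x : M | x \in N}.

HB.instance Definition _ := [isSub of submod for @sval M (fun x => x \in N)].
HB.instance Definition _ := [Choice of submod by <:].
HB.instance Definition _ := [SubChoice_isSubLmodule of submod by <:].

End Submodule.

(** M / N is the library's quotient group [Quotient.quot] with scalar
    multiplication a *: [x] = [a *: x]. *)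
Section QuotientModule.
Context (R : pzRingType) (M : lmodType R) (N : submodClosed M).

(** N as a [zmodClosed] predicate, as [Quotient.quot] requires. *)
Definition submod_pred : {pred M} := fun x => x \in N.

Fact submod_zmod_closed : zmod_closed submod_pred.
Proof.
split=> [|x y xN yN]; first exact: (rpred0 N).
by rewrite -scaleN1r; exact: (@rpredD _ N _ _ xN (@rpredZ _ _ N (-1) y yN)).
Qed.

HB.instance Definition _ :=
  GRing.isZmodClosed.Build M submod_pred submod_zmod_closed.

Definition quotmod : Type := Quotient.quot submod_pred.

HB.instance Definition _ := GRing.Zmodule.on quotmod.

Definition quotmod_pi (x : M) : quotmod := \pi_(Quotient.quot submod_pred) x.

Definition quotmod_scale (a : R) (x : quotmod) : quotmod :=
  quotmod_pi (a *: (repr (x : Quotient.quot submod_pred) : M)).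

Lemma quotmod_piP (x : quotmod) : exists y, quotmod_pi y = x.
Proof. by exists (repr (x : Quotient.quot submod_pred)); exact: reprK. Qed.

Lemma quotmod_pi_eq (x y : M) : (quotmod_pi x == quotmod_pi y) = (x - y \in N).
Proof. by rewrite -[RHS]/(x - y \in submod_pred) Quotient.idealrBE. Qed.

Lemma quotmod_piD : {morph quotmod_pi : x y / x + y}.
Proof. exact: raddfD. Qed.

Lemma quotmod_piZ (a : R) (x : M) :
  quotmod_scale a (quotmod_pi x) = quotmod_pi (a *: x).
Proof.
apply/eqP; rewrite quotmod_pi_eq -scalerBr rpredZ // -quotmod_pi_eq.
by apply/eqP; exact: reprK.
Qed.

Fact quotmod_scaleA (a b : R) (v : quotmod) :
  quotmod_scale a (quotmod_scale b v) = quotmod_scale (a * b) v.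
Proof. by have [x <-] := quotmod_piP v; rewrite !quotmod_piZ scalerA. Qed.

Fact quotmod_scale1 : left_id 1 quotmod_scale.
Proof. by move=> v; have [x <-] := quotmod_piP v; rewrite quotmod_piZ scale1r. Qed.

Fact quotmod_scaleDr : right_distributive quotmod_scale +%R.
Proof.
move=> a u v; have [x <-] := quotmod_piP u; have [y <-] := quotmod_piP v.
by rewrite -quotmod_piD !quotmod_piZ -quotmod_piD scalerDr.
Qed.

Fact quotmod_scaleDl v : {morph quotmod_scale^~ v : a b / a + b}.
Proof.
move=> a b; have [x <-] := quotmod_piP v.
by rewrite !quotmod_piZ -quotmod_piD scalerDl.
Qed.

HB.instance Definition _ := GRing.Zmodule_isLmodule.Build R quotmod
  quotmod_scaleA quotmod_scale1 quotmod_scaleDr quotmod_scaleDl.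

End QuotientModule.

(** Ideals of a commutative ring R are the submodules of the regular module
    R^o. *)
Definition noetherian (R : comPzRingType) : Prop :=
  forall I : submodClosed R^o, finitely_generated (submod I).

Definition maximal_ideal (R : comPzRingType) (m : submodClosed R^o) : Prop :=
  (1 : R^o) \notin m /\
  forall I : submodClosed R^o, {subset m <= I} -> (1 : R^o) \notin I -> I =i m.

(** The residue field at m, as the R-module R / m. *)
Definition residue (R : comPzRingType) (m : submodClosed R^o) : lmodType R :=
  quotmod m.

(** The target of a ring homomorphism, as a module over its source. *)
Section RestrictionOfScalars.
Context (R S : pzRingType) (phi : {rmorphism R -> S}).

Definition restrict_scalars & {rmorphism R -> S} : Type := S.

Local Notation S_R := (restrict_scalars phi).

HB.instance Definition _ := GRing.Zmodule.on S_R.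

Definition restrict_scale (a : R) (x : S_R) : S_R := phi a * (x : S).

Fact restrict_scaleA (a b : R) (x : S_R) :
  restrict_scale a (restrict_scale b x) = restrict_scale (a * b) x.
Proof. by rewrite /restrict_scale rmorphM mulrA. Qed.

Fact restrict_scale1 : left_id 1 restrict_scale.
Proof. by move=> x; rewrite /restrict_scale rmorph1 mul1r. Qed.

Fact restrict_scaleDr : right_distributive restrict_scale +%R.
Proof. by move=> a x y; exact: mulrDr. Qed.

Fact restrict_scaleDl x : {morph restrict_scale^~ x : a b / a + b}.
Proof. by move=> a b; rewrite /restrict_scale rmorphD; exact: mulrDl. Qed.

HB.instance Definition _ := GRing.Zmodule_isLmodule.Build R S_R
  restrict_scaleA restrict_scale1 restrict_scaleDr restrict_scaleDl.

End RestrictionOfScalars.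

Section GeneratedSubgroup.
Context (V : zmodType) (S : set V).

Definition gen_subgroup : {pred V} :=
  fun x => `[< forall G : zmodClosed V, (forall y, S y -> y \in G) -> x \in G >].

Fact gen_subgroup_zmod_closed : zmod_closed gen_subgroup.
Proof.
split=> [|x y /asboolP xG /asboolP yG]; apply/asboolP => G SG; first exact: rpred0.
by rewrite rpredB ?xG ?yG.
Qed.

HB.instance Definition _ :=
  GRing.isZmodClosed.Build V gen_subgroup gen_subgroup_zmod_closed.

End GeneratedSubgroup.

(** The tensor product A ⊗_R B, as an abelian group: the free abelian group on
    A * B modulo the subgroup generated by the bilinearity relations. *)
Section TensorProduct.
Context (R : comPzRingType) (A B : lmodType R).

Local Notation "[ a , b ]" := (Freeg [:: (1, (a, b))] : {freeg (A * B)%type}).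

Inductive tensor_relation : set {freeg (A * B)%type} :=
| tensor_relDl a a' b : tensor_relation ([a + a', b] - [a, b] - [a', b])
| tensor_relDr a b b' : tensor_relation ([a, b + b'] - [a, b] - [a, b'])
| tensor_relZ r a b : tensor_relation ([r *: a, b] - [a, r *: b]).

Definition tensor : Type := Quotient.quot (gen_subgroup tensor_relation).

HB.instance Definition _ := GRing.Zmodule.on tensor.

Definition tensor_pi (x : {freeg (A * B)%type}) : tensor :=
  \pi_(Quotient.quot (gen_subgroup tensor_relation)) x.

Definition tens (a : A) (b : B) : tensor := tensor_pi [a, b].

Definition tensor_repr (x : tensor) : {freeg (A * B)%type} :=
  repr (x : Quotient.quot (gen_subgroup tensor_relation)).

Lemma tensor_reprK : cancel tensor_repr tensor_pi.
Proof. by move=> x; exact: reprK. Qed.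

Lemma tensor_piB : {morph tensor_pi : x y / x - y}.
Proof. exact: raddfB. Qed.

Lemma tensor_piD : {morph tensor_pi : x y / x + y}.
Proof. exact: raddfD. Qed.

Lemma tensor_pi_eq x y :
  (tensor_pi x == tensor_pi y) = (x - y \in gen_subgroup tensor_relation).
Proof. by rewrite Quotient.idealrBE. Qed.

Lemma tensor_pi_rel x : tensor_relation x -> tensor_pi x = 0.
Proof.
move=> rx; rewrite -(subrr (tensor_pi 0)) -tensor_piB subrr.
by apply/eqP; rewrite tensor_pi_eq subr0; apply/asboolP => G; exact.
Qed.

Lemma tensDl a a' b : tens (a + a') b = tens a b + tens a' b.
Proof.
apply/eqP; rewrite -subr_eq0 opprD addrA -!tensor_piB tensor_pi_rel //.
exact: tensor_relDl.
Qed.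

Lemma tensDr a b b' : tens a (b + b') = tens a b + tens a b'.
Proof.
apply/eqP; rewrite -subr_eq0 opprD addrA -!tensor_piB tensor_pi_rel //.
exact: tensor_relDr.
Qed.

Lemma tensZ r a b : tens (r *: a) b = tens a (r *: b).
Proof.
apply/eqP; rewrite -subr_eq0 -tensor_piB tensor_pi_rel //.
exact: tensor_relZ.
Qed.

Section Lift.
Context (V : zmodType) (h : A -> B -> V).

Definition free_lift : {freeg (A * B)%type} -> V :=
  fglift (fun p => h p.1 p.2 : zmodule V).

Fact free_lift_zmod_morphism : zmod_morphism free_lift.
Proof. by move=> x y; exact: (@lift_is_additive _ _ (zmodule V)). Qed.

HB.instance Definition _ :=
  GRing.isZmodMorphism.Build _ _ free_lift free_lift_zmod_morphism.

Lemma free_liftE a b : free_lift [a, b] = h a b.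
Proof. by rewrite /free_lift liftU scale1r. Qed.

(** The map a ⊗ b |-> h a b; it is well defined when h is R-balanced. *)
Definition tensor_lift (x : tensor) : V :=
  free_lift (tensor_repr x).

Definition balanced : Prop :=
  [/\ forall a a' b, h (a + a') b = h a b + h a' b,
      forall a b b', h a (b + b') = h a b + h a b'
    & forall r a b, h (r *: a) b = h a (r *: b)].

Hypothesis h_bal : balanced.

Definition lift_ker : {pred {freeg (A * B)%type}} := fun x => free_lift x == 0.

Fact lift_ker_zmod_closed : zmod_closed lift_ker.
Proof.
split=> [|x y /eqP x0 /eqP y0]; apply/eqP; first exact: raddf0.
by rewrite free_lift_zmod_morphism x0 y0 subr0.
Qed.

HB.instance Definition _ :=
  GRing.isZmodClosed.Build {freeg (A * B)%type} lift_ker lift_ker_zmod_closed.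

Lemma tensor_lift_pi x : tensor_lift (tensor_pi x) = free_lift x.
Proof.
apply/eqP; rewrite /tensor_lift -subr_eq0 -raddfB; set y := tensor_repr _.
have : y - x \in gen_subgroup tensor_relation.
  by rewrite -tensor_pi_eq tensor_reprK.
move/asboolP/(_ lift_ker); apply => z; case: h_bal => hDl hDr hZ.
by case=> [a a' b|a b b'|r a b]; rewrite unfold_in !raddfB /= !free_liftE
  ?hDl ?hDr ?hZ ?subrr // addrAC addrK subrr.
Qed.

Lemma tensor_liftE a b : tensor_lift (tens a b) = h a b.
Proof. by rewrite tensor_lift_pi free_liftE. Qed.

Lemma tensor_liftD : {morph tensor_lift : x y / x + y}.
Proof.
move=> x y; rewrite -[x]tensor_reprK -[y]tensor_reprK.
by rewrite -tensor_piD !tensor_lift_pi raddfD.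
Qed.

End Lift.

End TensorProduct.

(** f ⊗ id_B : A ⊗_R B -> A' ⊗_R B *)
Section TensorMap.
Context (R : comPzRingType) (A A' B : lmodType R) (f : {linear A -> A'}).

Definition tensor_mapl : tensor A B -> tensor A' B :=
  tensor_lift (fun a b => tens (f a) b).

Lemma tensor_mapl_balanced : balanced (fun a (b : B) => tens (f a) b).
Proof.
by split=> *; rewrite ?raddfD ?linearZ (tensDl, tensDr, tensZ).
Qed.

Lemma tensor_maplE a b : tensor_mapl (tens a b) = tens (f a) b.
Proof. exact: tensor_liftE tensor_mapl_balanced a b. Qed.

Lemma tensor_maplD : {morph tensor_mapl : x y / x + y}.
Proof. exact: tensor_liftD tensor_mapl_balanced. Qed.

End TensorMap.

Section Closures.
Context (R : comPzRingType) (M : lmodType R) (N : submodClosed M).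

Definition submod_incl : {linear submod N -> M} := val.

(** im(N ⊗_R B -> M ⊗_R B); it is the same set whether the tensor products
    are regarded as groups, R-modules or (for B a field) vector spaces. *)
Definition tensor_im (B : lmodType R) : set (tensor M B) :=
  range (@tensor_mapl R (submod N) M B submod_incl).

Definition mod_rad : set M :=
  [set s | forall (K : fieldType) (phi : {rmorphism R -> K}),
     tensor_im (tens s ((1 : K) : restrict_scalars phi))].

Definition mod_Jac : set M :=
  [set s | forall m : submodClosed R^o, maximal_ideal m ->
     tensor_im (tens s (quotmod_pi m (1 : R^o) : residue m))].

End Closures.

(* Main.v *)
(* By Zorn's lemma the nonzero finitely generated module M / N has a maximal
   proper submodule, i.e. a surjection f onto R / m for some maximal ideal m.
   If B is an R-module killed by m, then s ⊗ b |-> f(s) b vanishes on the image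
   of N ⊗ B; choosing s with f(s) = 1 shows that s ⊗ b is not in that image for
   b <> 0. Both claims follow, with B = R / m seen as a module or as a field. *)

Require Import Defs.
From HB Require Import structures.
From mathcomp Require Import all_boot all_algebra ring_quotient.
From mathcomp Require Import boolp classical_sets.
From mathcomp Require Import freeg.

Set Implicit Arguments.
Unset Strict Implicit.
Unset Printing Implicit Defensive.

Import GRing.Theory.
Local Open Scope ring_scope.
Local Open Scope classical_set_scope.

(** * Maximal proper submodules of finitely generated modules *)

Section MaximalSubmodule.
Context (R : pzRingType) (V : lmodType R).

(** Turns the [Prop]-valued sets produced by Zorn's lemma into the bundled boolean predicates of
    [submodClosed]. *)
Lemma submodClosed_of_set (A : set V) :
    A 0 -> (forall a x y, A x -> A y -> A (a *: x + y)) ->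
  exists L : submodClosed V, forall x, (x \in L) = `[< A x >].
Proof.
move=> A0 Alin; pose P : {pred V} := fun x => `[< A x >].
have Pcl : submod_closed P.
  split=> [|a x y /asboolP Ax /asboolP Ay]; apply/asboolP => //.
  exact: Alin.
pose L : submodClosed V := HB.pack P (GRing.isSubmodClosed.Build R V P Pcl).
by exists L.
Qed.

Definition maximal_submod (L : submodClosed V) : Prop :=
  (exists v, v \notin L) /\
  forall L' : submodClosed V, {subset L <= L'} -> (exists v, v \notin L') ->
    {subset L' <= L}.

(** Zorn's lemma for sets closed under linear combinations that miss some generator. If the union of
    a chain contained all generators, then, these being finitely many, one member of the chain would
    contain them all. *)
Lemma finitely_generated_maximal_submod :
    finitely_generated V -> (exists x : V, x <> 0) ->
  exists L : submodClosed V, maximal_submod L.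
Proof.
move=> [n [g gV]] [x0 x0N0].
(* Membership of 0 is not demanded, so that the union of the empty chain satisfies [P]. *)
pose P (A : set V) := (forall a x y, A x -> A y -> A (a *: x + y)) /\
  exists i, ~ A (g i).
have [i0 gi0] : exists i, g i <> 0.
  apply: contrapT => /forallNP g0; apply: x0N0; have [c ->] := gV x0.
  by apply: big1 => i _; rewrite (contrapT (g0 i)) scaler0.
have [F FP Ftot|A [[Alin [j Agj]] Amax]] := @Zorn_bigcup V P.
  split=> [a x y [X FX Xx] [Y FY Yy]|].
    have [XY|YX] := Ftot _ _ FX FY.
      by exists Y => //; apply: (FP _ FY).1 => //; exact: XY.
    by exists X => //; apply: (FP _ FX).1 => //; exact: YX.
  apply: contrapT => /forallNP gF.
  have {}gF i : exists2 X, F X & X (g i) by exact: contrapT (gF i).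
  have [X FX Xg] : exists2 X, F X & forall i, i \in enum 'I_n -> X (g i).
    elim: (enum _) => [|i s [X FX Xs]].
      by have [X FX _] := gF i0; exists X.
    have [Y FY Yi] := gF i.
    have [XY|YX] := Ftot _ _ FX FY.
      exists Y => // k; rewrite inE => /orP[/eqP->//|ks].
      by apply: XY; exact: Xs.
    exists X => // k; rewrite inE => /orP[/eqP->|]; last exact: Xs.
    exact: YX.
  by have [_ [i []]] := FP _ FX; apply: Xg; rewrite mem_enum.
(* If [A] were empty, the set {0}, which misses the nonzero generator [g i0], would be strictly
   larger and still satisfy [P]. *)
have A0 : A 0.
  have [[x Ax]|/forallNP noA] := pselect (exists x, A x).
    by have := Alin (-1) x x Ax Ax; rewrite scaleN1r addNr.
  case: (Amax [set 0]) => [|].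
    split=> [x /noA//|/(_ 0 erefl)]; exact: noA.
  split=> [a x y -> ->|]; first by rewrite scaler0 addr0.
  by exists i0.
have [L LE] := submodClosed_of_set A0 Alin.
exists L; split=> [|L' LL' [v vL']].
  by exists (g j); rewrite LE; apply/asboolPn.
move=> x xL'; apply: contrapT => xNL; apply: (Amax [set` L']).
  split=> [y Ay|/(_ _ xL') Ax]; first by apply: LL'; rewrite LE; apply/asboolP.
  by apply: xNL; rewrite LE; apply/asboolP.
split=> [a y z /= yL zL|]; first by rewrite rpredD ?rpredZ.
apply: contrapT => /forallNP gL; case/negP: vL'; have [c ->] := gV v.
by apply: rpred_sum => i _; apply: rpredZ; exact: contrapT (gL i).
Qed.

(* L + R v is a submodule strictly larger than L, hence everything. *)
Lemma maximal_submod_coord (L : submodClosed V) v :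
  maximal_submod L -> v \notin L -> forall x, exists r, x - r *: v \in L.
Proof.
move=> [_ Lmax] vL x; apply: contrapT => xN.
have [||L' L'E] := @submodClosed_of_set [set y | exists r, y - r *: v \in L].
- by exists 0; rewrite scale0r subr0 rpred0.
- move=> a y z [r yr] [s zs]; exists (a * r + s).
  by rewrite scalerDl -scalerA opprD addrACA -scalerBr rpredD ?rpredZ.
case/negP: vL; apply: (Lmax L').
- by move=> y yL; rewrite L'E; apply/asboolP; exists 0; rewrite scale0r subr0.
- by exists x; rewrite L'E; apply/asboolPn.
- by rewrite L'E; apply/asboolP; exists 1; rewrite scale1r subrr rpred0.
Qed.

End MaximalSubmodule.

(** * The module R / m: functionals onto it and its action on modules killed by m *)

Section Residue.
Context (R : comPzRingType).
Implicit Type m : submodClosed R^o.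

(** The ideal m + R a is strictly larger than m, hence contains 1. *)
Lemma maximal_ideal_inv m (a : R) : maximal_ideal m -> (a : R^o) \notin m ->
  exists r : R, (1 - r * a : R^o) \in m.
Proof.
move=> [m1 mmax] am; apply: contrapT => /forallNP aN.
have [||I IE] := @submodClosed_of_set R R^o
   [set y | exists r : R, (y - r * a : R^o) \in m].
- by exists 0; rewrite mul0r subr0 rpred0.
- move=> b y z [r yr] [s zs]; exists (b * r + s).
  by rewrite mulrDl -mulrA opprD addrACA -mulrBr rpredD // [_ * _]/(b *: _) rpredZ.
case/negP: am; rewrite -(mmax I).
- by rewrite IE; apply/asboolP; exists 1; rewrite mul1r subrr rpred0.
- by move=> y yL; rewrite IE; apply/asboolP; exists 0; rewrite mul0r subr0.
- by rewrite IE; apply/asboolPn => -[r]; exact: aN.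
Qed.

(** Take [v] outside a maximal submodule [L] and let m be the ideal of all r with r v in [L]. Since
    V = L + R v, sending r v + L to the class of r identifies V / L with R / m. *)
Lemma residue_functional (V : lmodType R) :
    finitely_generated V -> (exists x : V, x <> 0) ->
  exists m, maximal_ideal m /\
  exists (f : {linear V -> residue m}) v, f v = quotmod_pi m (1 : R^o).
Proof.
move=> Vfg V0; have [L Lmax] := finitely_generated_maximal_submod Vfg V0.
have [v vL] := Lmax.1; have coord := maximal_submod_coord Lmax vL.
have [||m mE] := @submodClosed_of_set R R^o [set r : R^o | (r : R) *: v \in L].
- by rewrite /= scale0r rpred0.
- move=> a x y /= xL yL; rewrite [a *: x]/(a * x) scalerDl -scalerA.
  by rewrite rpredD // rpredZ.
have {}mE (r : R) : ((r : R^o) \in m) = (r *: v \in L) by rewrite mE /= asboolb.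
exists m; split.
  split=> [|I mI I1 r]; first by rewrite mE scale1r.
  apply/idP/idP => [rI|]; last exact: mI.
  (* As r v is outside [L], some a has v - a r v in [L], that is, 1 - a r in m; then 1 = (1 - a r) +
     a r lies in [I]. *)
  apply: contraNT I1; rewrite mE => rvL.
  have [a] := maximal_submod_coord Lmax rvL v.
  rewrite -{1}[v]scale1r scalerA -scalerBl -mE => /mI aI.
  by rewrite -[1](subrK (a * r : R^o)) rpredD // [a * r]/(a *: _) rpredZ.
pose c x : R := xget 0 [set r | x - r *: v \in L].
have cP x : x - c x *: v \in L.
  exact: (@xgetPex _ 0 [set r | x - r *: v \in L] (coord x)).
pose f x : residue m := quotmod_pi m (c x : R^o).
(* Two coordinates of [x] differ by an element of m, so [f] does not depend on the choice made by
   [c]; linearity follows. *)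
have fE (r : R) x : x - r *: v \in L -> f x = quotmod_pi m (r : R^o).
  move=> xr; apply/eqP; rewrite quotmod_pi_eq mE scalerBl.
  have -> : c x *: v - r *: v = (x - r *: v) - (x - c x *: v).
    by rewrite opprB [RHS]addrC addrA subrK.
  exact: (submod_zmod_closed L).2 xr (cP x).
have flin : linear f.
  move=> a x y; rewrite (fE (a * c x + c y)).
    by rewrite quotmod_piD [a * c x]/(a *: (c x : R^o)) -quotmod_piZ.
  by rewrite scalerDl -scalerA opprD addrACA -scalerBr rpredD ?rpredZ.
pose F : {linear V -> residue m} := HB.pack f (GRing.isLinear.Build R V _ _ f flin).
by exists F, v; apply: fE; rewrite scale1r subrr rpred0.
Qed.

Section Action.
Context (m : submodClosed R^o) (B : lmodType R).
Hypothesis mB0 : forall (a : R) (b : B), (a : R^o) \in m -> a *: b = 0.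

(** Scalar multiplication by R / m through a representative, whose choice does not matter when m
    kills [B]. *)
Definition residue_act (x : residue m) (b : B) : B :=
  (repr (x : Quotient.quot (submod_pred m)) : R) *: b.

Lemma residue_act_pi (a : R) b : residue_act (quotmod_pi m (a : R^o)) b = a *: b.
Proof.
apply/eqP; rewrite -subr_eq0 -scalerBl mB0 // -quotmod_pi_eq.
by apply/eqP; exact: reprK.
Qed.

Lemma residue_actDl x y b :
  residue_act (x + y) b = residue_act x b + residue_act y b.
Proof.
have [a <-] := quotmod_piP x; have [a' <-] := quotmod_piP y.
by rewrite -quotmod_piD !residue_act_pi scalerDl.
Qed.

Lemma residue_actZl (r : R) x b :
  residue_act (r *: x) b = residue_act x (r *: b).
Proof.
have [a <-] := quotmod_piP x; rewrite [_ *: _]quotmod_piZ !residue_act_pi.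
by rewrite scalerA; congr (_ *: _); exact: mulrC.
Qed.

End Action.

(** Makes [residue_act] available with [B] = R / m, where it is the ring multiplication. *)
Lemma residue_killed m (a : R) (x : residue m) : (a : R^o) \in m -> a *: x = 0.
Proof.
move=> am; have [b <-] := quotmod_piP x; rewrite [_ *: _]quotmod_piZ.
have -> : 0 = quotmod_pi m 0 by rewrite /quotmod_pi raddf0.
apply/eqP; rewrite quotmod_pi_eq subr0.
by rewrite (_ : a *: b = b *: (a : R^o)) ?rpredZ //; exact: mulrC.
Qed.

End Residue.

(** * The field structure on R / m *)

Section ResidueField.
Context (R : comPzRingType) (m : submodClosed R^o).

(** The type records the proof of maximality, on which the field instance depends. *)
Definition residue_field & maximal_ideal m : Type := quotmod m.

Context (m_max : maximal_ideal m).
Local Notation k := (residue_field m_max).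

HB.instance Definition _ := GRing.Zmodule.on k.

Definition residue_field_pi (a : R) : k := quotmod_pi m (a : R^o).

Definition residue_field_mul (x y : k) : k :=
  residue_act (x : residue m) (y : residue m).

Lemma residue_field_piP (x : k) : exists a, residue_field_pi a = x.
Proof. exact: (@quotmod_piP R R^o m x). Qed.

Lemma residue_field_piM (a b : R) :
  residue_field_mul (residue_field_pi a) (residue_field_pi b) =
  residue_field_pi (a * b).
Proof.
rewrite /residue_field_mul residue_act_pi; last exact: residue_killed.
exact: quotmod_piZ.
Qed.

Fact residue_field_piB : zmod_morphism residue_field_pi.
Proof. by move=> a b; exact: raddfB. Qed.

HB.instance Definition _ :=
  GRing.isZmodMorphism.Build R k residue_field_pi residue_field_piB.

Lemma residue_field_pi_eq0 (a : R) :
  (residue_field_pi a == 0) = ((a : R^o) \in m).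
Proof. by rewrite -(raddf0 residue_field_pi) [LHS]quotmod_pi_eq subr0. Qed.

Fact residue_field_mulA : associative residue_field_mul.
Proof.
move=> x y z; have [a <-] := residue_field_piP x.
have [b <-] := residue_field_piP y; have [c <-] := residue_field_piP z.
by rewrite !residue_field_piM mulrA.
Qed.

Fact residue_field_mulC : commutative residue_field_mul.
Proof.
move=> x y; have [a <-] := residue_field_piP x.
by have [b <-] := residue_field_piP y; rewrite !residue_field_piM mulrC.
Qed.

Fact residue_field_mul1 : left_id (residue_field_pi 1) residue_field_mul.
Proof.
by move=> x; have [a <-] := residue_field_piP x; rewrite residue_field_piM mul1r.
Qed.

Fact residue_field_mulDl : left_distributive residue_field_mul +%R.
Proof.
move=> x y z; have [a <-] := residue_field_piP x.
have [b <-] := residue_field_piP y; have [c <-] := residue_field_piP z.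
by rewrite -raddfD !residue_field_piM -raddfD mulrDl.
Qed.

Fact residue_field_1_neq0 : residue_field_pi 1 != 0.
Proof. by rewrite residue_field_pi_eq0; case: m_max. Qed.

HB.instance Definition _ := GRing.Zmodule_isComNzRing.Build k
  residue_field_mulA residue_field_mulC residue_field_mul1 residue_field_mulDl
  residue_field_1_neq0.

Definition residue_field_inv (x : k) : k :=
  if x == 0 then 0 else xget 0 [set y | y * x = 1].

Fact residue_field_mulV x : x != 0 -> residue_field_inv x * x = 1.
Proof.
rewrite /residue_field_inv => xN0; rewrite (negPf xN0).
have [a aE] := residue_field_piP x.
have : (a : R^o) \notin m by rewrite -residue_field_pi_eq0 aE.
case/(maximal_ideal_inv m_max) => r ram.
apply: (@xgetPex _ 0 [set y | y * x = 1]); exists (residue_field_pi r).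
rewrite /= -aE; apply/esym/eqP; rewrite -subr_eq0.
by rewrite [_ * _]residue_field_piM -raddfB residue_field_pi_eq0.
Qed.

Fact residue_field_inv0 : residue_field_inv 0 = 0.
Proof. by rewrite /residue_field_inv eqxx. Qed.

HB.instance Definition _ :=
  GRing.ComNzRing_isField.Build k residue_field_mulV residue_field_inv0.

Fact residue_field_pi_monoid : monoid_morphism residue_field_pi.
Proof. by split=> // a b; rewrite [RHS]residue_field_piM. Qed.

HB.instance Definition _ :=
  GRing.isMonoidMorphism.Build R k residue_field_pi residue_field_pi_monoid.

End ResidueField.

(** * Tensors outside the image of N ⊗ B *)

Section TensorImage.
Context (R : comPzRingType).

(** Pure tensors generate the tensor product as a group: a representative in the free abelian group
    is a sum of integer multiples of pairs. *)
Lemma tensor_ind (A B : lmodType R) (P : tensor A B -> Prop) :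
    P 0 -> (forall x y, P x -> P y -> P (x - y)) ->
    (forall a b, P (tens a b)) ->
  forall x, P x.
Proof.
move=> P0 PB Pt x; rewrite -[x]tensor_reprK.
have Popp y : P y -> P (- y) by rewrite -[- y]add0r; exact: PB.
have Padd y z : P y -> P z -> P (y + z).
  by move=> Py Pz; rewrite -[z]opprK; apply/PB/Popp.
elim/freeg_ind_dom0: (tensor_repr x) => [|k [a b] D _ _ PD].
  by rewrite -(subrr 0) tensor_piB subrr.
rewrite tensor_piD; apply: (Padd _ _ _ PD).
have Pn (n : nat) : P (tensor_pi << n%:Z *g (a, b) >>).
  elim: n => [|n IHn]; first by rewrite freegU0 -(subrr 0) tensor_piB subrr.
  by rewrite intS -freegUD tensor_piD; apply: Padd => //; exact: Pt.
case: k => [n|n]; first exact: Pn.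
rewrite NegzE -freegUN -[- _]add0r tensor_piB; apply: PB; last exact: Pn.
by rewrite -(subrr 0) tensor_piB subrr.
Qed.

(** The additive map M ⊗ B -> B induced by [h] kills n ⊗ y for n in N, because the class of n is 0,
    but sends s ⊗ b to b. *)
Lemma notin_tensor_im (M : lmodType R) (N : submodClosed M)
    (m : submodClosed R^o) (f : {linear quotmod N -> residue m})
    (B : lmodType R) (s : M) (b : B) :
    (forall (a : R) (b' : B), (a : R^o) \in m -> a *: b' = 0) ->
    f (quotmod_pi N s) = quotmod_pi m (1 : R^o) -> b != 0 ->
  ~ tensor_im N (tens s b).
Proof.
move=> mB0 fs bN0 [t _ tE].
pose h (x : M) (y : B) := residue_act (f (quotmod_pi N x)) y.
have h_bal : balanced h.
  split=> [x x' y|x y y'|r x y]; rewrite /h.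
  - by rewrite quotmod_piD raddfD residue_actDl.
  - exact: scalerDr.
  - by rewrite -quotmod_piZ linearZ residue_actZl.
have h0 u : tensor_lift h (tensor_mapl (submod_incl N) u) = 0.
  elim/tensor_ind: u => [|u v u0 v0|n y].
  (* The values at 0 and at u - v are both derived from additivity by cancellation. *)
  - apply: (addIr (tensor_lift h (tensor_mapl (submod_incl N) 0))).
    by rewrite -tensor_liftD // -tensor_maplD !addr0 add0r.
  - rewrite -[LHS]addr0 -{1}v0.
    by rewrite -tensor_liftD // -tensor_maplD subrK.
  - rewrite tensor_maplE tensor_liftE // /h.
    have -> : quotmod_pi N (submod_incl N n) = quotmod_pi N 0.
      by apply/eqP; rewrite quotmod_pi_eq subr0; exact: valP n.
    have -> : quotmod_pi N 0 = 0 by exact: raddf0.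
    have -> : f 0 = quotmod_pi m 0 by rewrite raddf0; symmetry; exact: raddf0.
    by rewrite residue_act_pi // scale0r.
have := h0 t; rewrite tE tensor_liftE // /h fs residue_act_pi // scale1r.
exact/eqP.
Qed.

End TensorImage.

Theorem corollary3p3p8 (R : comPzRingType) (M : lmodType R)
    (N : submodClosed M) :
  noetherian R ->
  (exists x : quotmod N, x <> 0) ->
  finitely_generated (quotmod N) ->
  mod_Jac N <> [set: M] /\ mod_rad N <> [set: M].
Proof.
move=> _ N0 Nfg; have [m [m_max [f [v fv]]]] := residue_functional Nfg N0.
have [s sE] := quotmod_piP v; rewrite -{}sE in fv.
split=> /seteqP[_ /(_ s I)].
  move=> /(_ m m_max); apply: notin_tensor_im fv _ => [a b|].
    exact: residue_killed.
  exact: (residue_field_1_neq0 m_max).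
(* The test field is R / m with its quotient map; as m is the kernel, m kills the module obtained by
   restriction of scalars. *)
move=> /(_ (residue_field m_max) (residue_field_pi m_max)).
apply: notin_tensor_im fv _ => [a b am|]; last exact: oner_neq0.
rewrite [a *: b]/(residue_field_pi m_max a * b).
by move: am; rewrite -(residue_field_pi_eq0 m_max) => /eqP->; exact: mul0r.
Qed.
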